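(* Let $k,s\ge 0$ be integers and let $G$ be a vertex-weighted undirected graph (with nonnegative vertex weights) that has a tree decomposition of width $k$ and elongation $s$. Let $a=k+1$ if $s\ge 2$, and $a=\lceil k/2\rceil$ if $s\le 1$. Then for every integer $t\ge 2$, $G$ has a $(t,g)$-trimming, where $g=(2(s+1)t-3)(k+1)$ if $a\le 1$, and \[ g=\frac{(a^{(s+1)t-2}(a+1)-2)(k+1)}{a-1} \] if $a\ge 2$. Consequently, for every constant $s\ge 0$, every family of graphs of bounded $s$-elongation treewidth is trimmable.
   Context: A tree decomposition of an undirected graph $G=(V,E)$ is a pair $(T,B)$ where $T=(X,E_T)$ is a tree and $B:X\to 2^V$ assigns to each node $x$ a bag $B(x)\subseteq V$ such that (i) the union over $x\in X$ of the induced subgraphs $G[B(x)]$ equals $G$ (i.e., every vertex and every edge lies in some induced bag subgraph), and (ii) for all $x,y,z\in X$, if $y$ lies on the path from $x$ to $z$ in $T$, then $B(x)\cap B(z)\subseteq B(y)$. Its width is $\max_{x\in X}|B(x)|-1$. Its elongation is the maximum number of edges on a simple path in $T$ between two nodes whose bags intersect. For $s\ge 0$, the $s$-elongation treewidth of $G$ is the smallest width of a tree decomposition of $G$ with elongation at most $s$. For $t>0$ and $g\ge 0$, a $(t,g)$-trimming of a vertex-weighted graph $G=(V,E)$ of total weight $W$ is a set $U\subseteq V$ of total weight at most $W/t$ such that every simple path in $G$ with more than $g$ edges contains a vertex of $U$. A family of graphs is trimmable if for every constant $t>0$ there is a constant $g\ge 0$ depending only on $t$ such that every vertex-weighted graph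 in the family (any nonnegative weights) has a $(t,g)$-trimming. *)

(* Defs.v *)
From HB Require Import structures.
From mathcomp Require Import all_boot all_order all_algebra.
From mathcomp Require Import boolp reals.

Set Implicit Arguments.
Unset Strict Implicit.
Unset Printing Implicit Defensive.

Import Order.TTheory GRing.Theory Num.Theory.
Local Open Scope ring_scope.

Record sgraph := SGraph {
  vertex :> finType;
  adj : rel vertex;
  adj_sym : symmetric adj;
  adj_irr : irreflexive adj
}.

(* The vertex sequence of the path is x :: p, so its number of edges is
   [size p] and its endpoints are x and [last x p]. *)
Definition simple_path (G : sgraph) (x : G) (p : seq G) : bool :=
  path (@adj G) x p && uniq (x :: p).

Definition is_tree (T : sgraph) : Prop :=
  [/\ (0 < #|T|)%N,
      forall x y : T, connect (@adj T) x y
    & forall c : seq T, (2 < size c)%N -> ~ ucycle (@adj T) c].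

Record tree_decomposition (G : sgraph) := TreeDecomposition {
  td_tree : sgraph;
  td_tree_is_tree : is_tree td_tree;
  td_bag : td_tree -> {set G};
  td_vertex_cover : forall v : G, exists x, v \in td_bag x;
  td_edge_cover : forall u v : G, adj u v ->
    exists x, u \in td_bag x /\ v \in td_bag x;
  td_path : forall (x y z : td_tree) (p : seq td_tree),
    simple_path x p -> last x p = z -> y \in x :: p ->
    td_bag x :&: td_bag z \subset td_bag y
}.

(* Integer-valued: the width is -1 when all bags are empty. *)
Definition width (G : sgraph) (D : tree_decomposition G) : int :=
  (\max_(x : td_tree D) #|td_bag x|)%N%:Z - 1.

(* A simple path has fewer edges than the tree has nodes, so the bound on n
   loses nothing. The maximum is 0 when all bags are empty. *)
Definition elongation (G : sgraph) (D : tree_decomposition G) : nat :=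
  (\max_(n < #|td_tree D| |
     [exists x : td_tree D, exists p : n.-tuple (td_tree D),
        simple_path x p && (td_bag x :&: td_bag (last x p) != set0)]) n)%N.

Section SingleBag.
Variable G : sgraph.

Let unit_graph := @SGraph unit (fun _ _ => false) (fun _ _ => erefl)
  (fun _ => erefl).

Let unit_graph_is_tree : is_tree unit_graph.
Proof.
split=> [|[] []|[|x [|y c]] //= _]; first by rewrite card_unit.
exact: connect0.
Qed.

Definition single_bag : tree_decomposition G.
Proof.
apply: (@TreeDecomposition G unit_graph unit_graph_is_tree (fun=> setT)).
- by move=> v; exists tt; rewrite inE.
- by move=> u v _; exists tt; rewrite !inE.
- by move=> x y z p _ _ _; rewrite setIid.
Defined.

Lemma elongation_single_bag : elongation single_bag = 0%N.
Proof.
apply/eqP; rewrite -leqn0; apply/bigmax_leqP => -[n] /= + _.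
by rewrite card_unit ltnS.
Qed.

End SingleBag.

Definition has_decomposition (s : nat) (G : sgraph) (m : int) : Prop :=
  exists D : tree_decomposition G, (elongation D <= s)%N /\ width D = m.

Lemma ex_has_decomposition (s : nat) (G : sgraph) :
  exists n : nat, `[< has_decomposition s G (n%:Z - 1) >].
Proof.
exists (\max_(x : td_tree (single_bag G)) #|td_bag x|)%N; apply/asboolP.
by exists (single_bag G); rewrite elongation_single_bag.
Qed.

(* Widths are at least -1, hence of the form n - 1 with n a natural number;
   minimizing the width amounts to minimizing n. *)
Definition elongation_treewidth (s : nat) (G : sgraph) : int :=
  (ex_minn (ex_has_decomposition s G))%:Z - 1.

Definition trimming (R : realType) (G : sgraph) (w : G -> R) (t g : R)
    (U : {set G}) : Prop :=
  \sum_(v in U) w v <= (\sum_v w v) / t /\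
  forall (x : G) (p : seq G), simple_path x p -> g < (size p)%:R ->
    exists2 u, u \in x :: p & u \in U.

Definition trimmable (R : realType) (F : sgraph -> Prop) : Prop :=
  forall t : R, 0 < t -> exists2 g : R, 0 <= g &
    forall (G : sgraph) (w : G -> R), F G -> (forall v, 0 <= w v) ->
      exists U : {set G}, trimming w t g U.

Definition bounded_elongation_treewidth (s : nat) (F : sgraph -> Prop) : Prop :=
  exists k : int, forall G : sgraph, F G -> elongation_treewidth s G <= k.

(* Main.v *)
Require Import Defs.
From mathcomp Require Import all_boot all_order all_algebra.
From mathcomp Require Import boolp reals.
From mathcomp Require Import zify ring lra.

Set Implicit Arguments.
Unset Strict Implicit.
Unset Printing Implicit Defensive.

Import Order.TTheory GRing.Theory Num.Theory.

(* Root the decomposition tree and put M = (s + 1) t. A vertex occurs in bags on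
   at most s + 1 consecutive levels, so for some i < M the union U of the bags on
   the levels congruent to i modulo M weighs at most W / t. Let P be a path that
   avoids U, let r be a deepest node such that P lives in the bags at or below r,
   and keep r together with the nodes x strictly below r such that P contains a
   vertex that occurs at or below x but not in the bag of the parent of x. The
   bags of these nodes cover P, each of them meets P, and they are closed under
   taking parents up to r, hence occupy at most M - 1 levels. Deleting the bag of
   x from P leaves pieces that each live in one branch of the tree at x. A bag of
   k + 1 vertices leaves at most k + 2 pieces; when s <= 1, the bags of distinct
   neighbours of x share no vertex, so every branch visited, except the ones where
   P starts and ends, needs its own entry and exit vertices in the bag of x, and
   at most (k + 3) / 2 branches are visited. So r has at most a + 1 children among
   the nodes kept, and any other node at most a, because P also visits the branch
   of its parent. *)

(** * Edges where a path crosses the border of a set *)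

Lemma path_exit (T : eqType) (e : rel T) (A : pred T) x p :
  path e x p -> A x -> ~~ A (last x p) ->
  exists u v, [/\ e u v, u \in x :: p, v \in x :: p, A u & ~~ A v].
Proof.
elim: p x => [|y p IH] x /=; first by move=> _ ->.
move=> /andP[exy pth] Ax NA; case Ay : (A y).
  have [u [v [euv up vp Au Av]]] := IH y pth Ay NA.
  by exists u, v; rewrite !(in_cons x) up vp !orbT.
by exists x, y; rewrite !inE !eqxx orbT Ay.
Qed.

(** If [x] is in [A], walk from [x] to [b]; otherwise walk from [x] to [a] and turn the crossing
    edge around by symmetry. *)
Lemma path_boundary (T : eqType) (e : rel T) (A : pred T) x p a b :
  symmetric e -> path e x p -> a \in x :: p -> b \in x :: p ->
  A a -> ~~ A b ->
  exists u v, [/\ e u v, u \in x :: p, v \in x :: p, A u & ~~ A v].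
Proof.
move=> esym pth ap bp Aa Ab.
have from_head (B : pred T) c : c \in x :: p -> B x -> ~~ B c ->
    exists u v, [/\ e u v, u \in x :: p, v \in x :: p, B u & ~~ B v].
  move=> /splitPl cp; case: cp pth => p1 p2 lastc.
  rewrite cat_path => /andP[pth1 _] Bx Bc.
  rewrite -lastc in Bc; have [u [v [euv up vp Bu Bv]]] := path_exit pth1 Bx Bc.
  by exists u, v; rewrite -cat_cons !mem_cat up vp.
case Ax : (A x); first exact: from_head bp Ax Ab.
have [||u [v [euv up vp Bu Bv]]] := from_head (predC A) a ap; rewrite /= ?Ax ?Aa //.
by exists v, u; rewrite esym euv; split => //; move: Bv; rewrite negbK.
Qed.

(** * Counting labels along a sequence *)

Section LabelCount.
Variables (T L : eqType) (B : pred T) (c : T -> L).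

(** In use, [B] is a bag and [c] sends a vertex to its branch. *)
Definition labels (l : seq T) := undup [seq c v | v <- l & ~~ B v].

Lemma size_labels_cons v l : size (labels (v :: l)) <= ~~ B v + size (labels l).
Proof. by rewrite /labels /=; case: (B v) => //=; case: ifP. Qed.

Lemma labels_consB v l : B v -> labels (v :: l) = labels l.
Proof. by rewrite /labels /= => ->. Qed.

Lemma labels_cons_same v w l : ~~ B w -> c v = c w ->
  labels [:: v, w & l] = labels (w :: l).
Proof.
by rewrite /labels /= => -> cvw; case: (B v) => //=; rewrite cvw inE eqxx.
Qed.

(** A new label can appear only at the head or just after a vertex of [B]; the last summand pays for
    the head. *)
Lemma size_labels_sep v l :
  path (fun u v => ~~ B u && ~~ B v ==> (c u == c v)) v l ->
  size (labels (v :: l)) <= count B (v :: l) + ~~ B v.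
Proof.
elim: l v => [|w l IH] v /=.
  by rewrite (leq_trans (size_labels_cons v _)) //= addn0; case: (B v).
move=> /andP[evw /IH {}IH]; case Bv : (B v) => /=.
  by rewrite labels_consB //; move: IH => /=; case: (B w) => /=; lia.
move: evw IH => /=; case Bw : (B w) => /= evw IH.
  by have := size_labels_cons v (w :: l); rewrite Bv /=; lia.
by rewrite Bv /= in evw; rewrite labels_cons_same ?Bw ?(eqP evw) //; lia.
Qed.

(* Peels off two vertices when leaving a block: the boundary vertex carries
   the label of the block, so returning to the block at once costs nothing. *)
Lemma size_labels_boundary v l :
  path (fun u v => ~~ B u || ~~ B v ==> (c u == c v)) v l ->
  (size (labels (v :: l))).*2 <= count B (v :: l) + 1 + ~~ B v.
Proof.
have [n le_n] := ubnP (size l); elim: n => // n IH in v l le_n *.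
case: l le_n => [|w l] /= le_n.
  by have /= := size_labels_cons v [::]; rewrite /(labels [::]) /=; case: (B v) => /=; lia.
move=> /andP[evw pth]; have {}IH1 := IH w l le_n pth.
case Bv : (B v) => /=.
  by rewrite labels_consB //; move: IH1 => /=; case: (B w) => /=; lia.
rewrite Bv /= in evw; move: IH1 => /=; case Bw : (B w) => /= IH1; last first.
  by rewrite labels_cons_same ?Bw ?(eqP evw) //; lia.
have := size_labels_cons v (w :: l); rewrite Bv /= => sz.
case: l le_n pth sz IH1 => [|u l] le_n.
  by rewrite /labels /= Bv Bw.
move=> /= /andP[ewu pth] sz IH1.
have /= {IH} := IH u l (ltnW le_n) pth.
rewrite (labels_consB _ Bw) in sz.
move: IH1 ewu; case Bu : (B u) => /= IH1 ewu IH; first lia.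
rewrite Bw /= in ewu.
have -> : labels [:: v, w, u & l] = labels (u :: l); last lia.
rewrite -(@labels_cons_same v u l) ?Bu // ?(eqP evw) ?(eqP ewu) //.
by rewrite /labels /= Bw.
Qed.

End LabelCount.

(** * Unique paths in trees and rooting by levels *)

Lemma simple_path_exists (T : sgraph) (x y : T) :
  connect (@adj T) x y -> exists2 p, simple_path x p & last x p = y.
Proof.
by move=> /connectP[p /shortenP[q pth uq _] ->]; exists q; rewrite // /simple_path pth.
Qed.

Section Trees.
Variable T : sgraph.
Hypothesis treeT : is_tree T.

(** If the two paths leave [x] by different edges, the first vertex of one that lies on the other
    closes a cycle through [x]. *)
Lemma tree_path_uniq (x : T) p q :
  simple_path x p -> simple_path x q -> last x p = last x q -> p = q.
Proof.
have [_ _ acyc] := treeT.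
elim: p x q => [|a p IH] x [|b q] //=.
- by move=> _ /andP[_ /andP[/negP xq _]] /= xlast; case: xq; rewrite {1}xlast mem_last.
- by move=> /andP[_ /andP[/negP xp _]] _ /= xlast; case: xp; rewrite -{1}xlast mem_last.
move=> sp sq eql.
have [eab|neab] := eqVneq a b.
  rewrite -eab in sq eql *; congr (_ :: _); apply: IH eql.
    by move: sp => /andP[/= /andP[_ pp] /andP[_ up]]; rewrite /simple_path pp.
  by move: sq => /andP[/= /andP[_ pq] /andP[_ uq]]; rewrite /simple_path pq.
exfalso; move: sp sq => /andP[pp up] /andP[pq uq].
have hasq : has [in b :: q] (a :: p).
  by apply/hasP; exists (last a p); rewrite ?mem_last //= eql mem_last.
have [c [p1 [p2 [q1 [q2 [defp defq disj]]]]]] :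
    exists c p1 p2 q1 q2, [/\ a :: p = rcons p1 c ++ p2, b :: q = q1 ++ c :: q2
                           & ~~ has [in b :: q] p1].
  case: {pp up} (split_find hasq) => c p1 p2 cq disj.
  have cq' : c \in b :: q by [].
  case: {pq uq hasq cq eql} (splitPr cq') disj => q1 q2 disj.
  by exists c, p1, p2, q1, q2.
rewrite defp in pp up; rewrite defq in pq uq disj.
(* Since [a] and [b] differ, the cycle has at least three vertices. *)
have nnil : 0 < size p1 + size q1.
  case: p1 q1 defp defq {pp up pq uq disj} => [|? ?] [|? ?] //= [ac _] [bc _].
  by rewrite ac bc eqxx in neab.
apply: (acyc (x :: rcons p1 c ++ rev q1)).
  by rewrite /= size_cat size_rcons size_rev; lia.
move: pp pq; rewrite -cat_rcons !cat_path => /andP[pp _] /andP[pq _].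
apply/andP; split.
  rewrite /cycle rcons_cat cat_path pp last_rcons -rev_cons.
  have := rev_path (@adj T) x (rcons q1 c); rewrite last_rcons belast_rcons => ->.
  by rewrite (eq_path (e' := @adj T)) // => u v; rewrite adj_sym.
move: up uq; rewrite /= !mem_cat mem_rev !cat_uniq rev_uniq !negb_or /=.
move=> /andP[/andP[-> _] /andP[-> _]] /andP[/andP[-> _]] /and3P[-> /andP[cq _] _] /=.
rewrite andbT; apply/hasPn => u; rewrite mem_rev mem_rcons inE => uq1.
apply/norP; split; first by apply: contraNneq cq => <-.
by apply: contra disj => up1; apply/hasP; exists u; rewrite //= mem_cat uq1.
Qed.

Lemma tree_rooting : exists (lev : T -> nat) (par : T -> T) (r : T),
  [/\ forall x y, adj x y -> lev y = (lev x).+1 /\ par y = x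
                          \/ lev x = (lev y).+1 /\ par x = y,
      forall x, 0 < lev x -> lev x = (lev (par x)).+1
    & forall x, lev x = 0 -> x = r].
Proof.
have [/card_gt0P[r _] conn _] := treeT.
have /choice[pth pthP] : forall x, exists p, simple_path r p /\ last r p = x.
  by move=> x; have [p sp lp] := simple_path_exists (conn r x); exists p.
have pthE x p : simple_path r p -> last r p = x -> pth x = p.
  have [sx lx] := pthP x.
  by move=> sp lp; apply: tree_path_uniq sx sp _; rewrite lx.
(* The last vertex but one of the path from [r]; [r] becomes its own parent. *)
pose par y := last r (take (size (pth y)).-1 (pth y)).
have parE x y : pth y = rcons (pth x) y -> size (pth y) = (size (pth x)).+1 /\ par y = x.
  rewrite /par => ->; rewrite size_rcons /= -cats1 take_size_cat //.
  by have [_ ->] := pthP x.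
exists (fun x => size (pth x)), par, r; split.
- move=> x y exy; have [/andP[px ux] lx] := pthP x.
  (* If [y] is on the path to [x], then [x] extends the piece ending at [y]; otherwise [y] extends
     the path to [x]. *)
  have [yx|nyx] := boolP (y \in r :: pth x).
    right; apply: parE; have [p1 [p2 [def lp1]]] : exists p1 p2,
        pth x = p1 ++ p2 /\ last r p1 = y.
      by case/splitPl: yx => p1 p2 lp1; exists p1, p2.
    rewrite def cat_path -cat_cons cat_uniq in px ux.
    move: px ux => /andP[pp1 _] /and3P[up1 /hasPn p1x _].
    have sp1 : simple_path r p1 by rewrite /simple_path pp1.
    rewrite (pthE _ _ sp1 lp1).
    apply: pthE; last by rewrite last_rcons.
    rewrite /simple_path rcons_path pp1 lp1 adj_sym exy -rcons_cons rcons_uniq up1 andbT /=.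
    have nxy : x != y by apply: contraTneq exy => ->; rewrite adj_irr.
    case: p2 def p1x => [|z p2] def p1x.
      by rewrite -lx def cats0 lp1 eqxx in nxy.
    have /p1x : x \in z :: p2 by rewrite -lx def last_cat /= mem_last.
    by rewrite /= andbT.
  left; apply: parE; apply: pthE; last by rewrite last_rcons.
  by rewrite /simple_path rcons_path px lx exy -rcons_cons rcons_uniq nyx ux.
- move=> x; have [sx lx] := pthP x; case/lastP def: (pth x) sx lx => [|q z] //.
  rewrite /simple_path rcons_path last_rcons -rcons_cons rcons_uniq.
  move=> /andP[/andP[pq _] /andP[_ uq]] zx _; rewrite size_rcons; congr _.+1.
  rewrite (pthE (par x) q) ?/simple_path ?pq ?uq // /par def size_rcons -cats1.
  by rewrite take_size_cat.
by move=> x /size0nil px; have [_ <-] := pthP x; rewrite px.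
Qed.

End Trees.

(** * Counting bounds *)

Lemma leq_card_bigcup (I T : finType) (A : {set I}) (F : I -> {set T}) :
  #|\bigcup_(x in A) F x| <= \sum_(x in A) #|F x|.
Proof.
elim/big_rec2: _ => [|x m B _ le_Bm]; first by rewrite cards0.
by apply: leq_trans (leq_card_setU _ _) _; rewrite leq_add2l.
Qed.

(* Bounds the number of nodes at depth j in a rooted tree of maximum degree a + 1. *)
Definition level_bound a j := if j is j'.+1 then a.+1 * a ^ j' else 1.
Definition tree_bound a h := \sum_(j < h.+1) level_bound a j.

(** * Ancestors and subtrees in a rooted decomposition *)

Section RootedDecomposition.
Variables (G : sgraph) (D : tree_decomposition G).
Variables (lev : td_tree D -> nat) (par : td_tree D -> td_tree D) (r : td_tree D).
Hypothesis adj_lev : forall x y, adj x y -> lev y = (lev x).+1 /\ par y = x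
                                   \/ lev x = (lev y).+1 /\ par x = y.
Hypothesis lev_par : forall x, 0 < lev x -> lev x = (lev (par x)).+1.
Hypothesis lev_root : forall x, lev x = 0 -> x = r.

Local Notation bag := (@td_bag G D).

(** The first argument is the ancestor; a node is below itself. *)
Definition below x y := (lev x <= lev y) && (iter (lev y - lev x) par y == x).
(** The test [0 < lev z] excludes the root, on whose [par] nothing is assumed. *)
Definition child x z := (0 < lev z) && (par z == x).
Definition subtree_bag x : {set G} := \bigcup_(y | below x y) bag y.

Lemma belowxx x : below x x.
Proof. by rewrite /below leqnn subnn eqxx. Qed.

Lemma adj_odd_lev x y : adj x y -> odd (lev y) = ~~ odd (lev x).
Proof. by move=> /adj_lev[[-> _]|[-> _]] //=; rewrite negbK. Qed.

Lemma lev_child x z : child x z -> lev z = (lev x).+1.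
Proof. by move=> /andP[/lev_par -> /eqP->]. Qed.

Lemma child_neq_below x z : child x z -> ~~ below z x.
Proof. by move=> /lev_child lz; rewrite /below lz ltnn. Qed.

Lemma child_below x y z : child x z -> below z y -> below x y.
Proof.
move=> cz; have /andP[_ /eqP <-] := cz; move: (lev_child cz) => lz.
have /andP[/lev_par lp _] := cz.
rewrite /below => /andP[lzy /eqP {3}<-].
have -> : lev y - lev (par z) = (lev y - lev z).+1 by lia.
by rewrite iterS eqxx andbT; lia.
Qed.

Lemma lev_iter_par j y : j <= lev y -> lev (iter j par y) = lev y - j.
Proof.
elim: j => [|j IH] lj /=; first by rewrite subn0.
by have := @lev_par (iter j par y); rewrite IH; lia.
Qed.

Lemma below_root y : below r y.
Proof.
have top0 : lev (iter (lev y) par y) = 0 by rewrite lev_iter_par ?subnn.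
by rewrite /below -(lev_root top0) top0 subn0 eqxx.
Qed.

Lemma below_child x y : below x y -> y != x -> exists2 z, child x z & below z y.
Proof.
move=> /andP[lxy /eqP itx] nyx.
have ltxy : lev x < lev y.
  rewrite ltn_neqAle lxy andbT; apply: contraNneq nyx => exy.
  by rewrite -itx exy subnn.
have lz : lev (iter (lev y - lev x).-1 par y) = (lev x).+1.
  by rewrite lev_iter_par; lia.
exists (iter (lev y - lev x).-1 par y).
  rewrite /child lz /=; have <- := iterS (lev y - lev x).-1 par y.
  by rewrite prednK ?itx //; lia.
rewrite /below lz ltxy /=; apply/eqP; congr (iter _ par y); lia.
Qed.

Lemma below_par x y : below x y -> y != x -> below x (par y).
Proof.
move=> /andP[lxy /eqP itx] nyx.
have ltxy : lev x < lev y.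
  rewrite ltn_neqAle lxy andbT; apply: contraNneq nyx => exy.
  by rewrite -itx exy subnn.
have lp : lev y = (lev (par y)).+1 by apply: lev_par; lia.
rewrite /below -{3}itx; have -> : lev y - lev x = (lev (par y) - lev x).+1 by lia.
by rewrite iterSr eqxx andbT; lia.
Qed.

Lemma below_child_inj x z z' y :
  child x z -> child x z' -> below z y -> below z' y -> z = z'.
Proof.
move=> /lev_child lz /lev_child lz' /andP[_ /eqP <-] /andP[_ /eqP <-].
by rewrite lz lz'.
Qed.

(** Going down from a node below [x] stays below [x], and going up leaves only from [x] itself. *)
Lemma below_exit x n n' :
  adj n n' -> below x n -> ~~ below x n' -> n = x /\ n' = par x.
Proof.
move=> /adj_lev[[ln pn]|[ln pn]] bn nbn'.
  move: bn nbn'; rewrite /below => /andP[lxn /eqP {3}<-].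
  have -> : lev n' - lev x = (lev n - lev x).+1 by lia.
  by rewrite iterSr pn eqxx; lia.
have [nx|nx] := eqVneq n x; first by rewrite -pn nx.
by rewrite -pn (below_par bn nx) in nbn'.
Qed.

(** * Nodes whose bags share a vertex *)

Lemma bag_connected v (y w : td_tree D) : v \in bag y -> v \in bag w ->
  exists p, [/\ simple_path y p, last y p = w & forall n, n \in y :: p -> v \in bag n].
Proof.
have [_ conn _] := td_tree_is_tree D.
move=> vy vw; have [p sp lp] := simple_path_exists (conn y w).
exists p; split=> // n np; apply: (subsetP (td_path sp lp np)).
by rewrite inE vy.
Qed.

(** The tree path from [y] to [w] keeps [v] in all its bags and must use the edge between [x] and
    [par x]. *)
Lemma bag_exit v x y w : v \in bag y -> v \in bag w ->
  below x y -> ~~ below x w -> v \in bag x /\ v \in bag (par x).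
Proof.
move=> vy vw bxy bxw; have [p [/andP[pp _] lp vp]] := bag_connected vy vw.
rewrite -lp in bxw.
have [n [n' [enn' /vp vn /vp vn' bn bn']]] := path_exit pp bxy bxw.
by have [<- <-] := below_exit enn' bn bn'.
Qed.

Lemma subtree_bagP v x : reflect (exists2 y, below x y & v \in bag y) (v \in subtree_bag x).
Proof. exact: bigcupP. Qed.

Lemma subtree_bag_child x z : child x z -> {subset subtree_bag z <= subtree_bag x}.
Proof.
move=> cz v /subtree_bagP[y bzy vy]; apply/subtree_bagP; exists y => //.
exact: child_below bzy.
Qed.

Lemma adj_subtree_bag u v x : adj u v -> u \in subtree_bag x ->
  v \notin subtree_bag x -> u \in bag x /\ u \in bag (par x).
Proof.
move=> /(td_edge_cover D)[w [uw vw]] /subtree_bagP[y bxy uy] nvx.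
apply: bag_exit uy uw bxy _; apply: contra nvx => bxw.
by apply/subtree_bagP; exists w.
Qed.

Lemma bag_dist v x y : v \in bag x -> v \in bag y ->
  exists2 p, simple_path x p /\ last x p = y & size p <= elongation D.
Proof.
move=> vx vy; have [p [sp lp _]] := bag_connected vx vy; exists p => //.
have lt_p : size p < #|td_tree D|.
  by have /andP[_ /card_uniqP /= <-] := sp; exact: max_card.
rewrite /elongation -[size p]/(nat_of_ord (Ordinal lt_p)).
apply: leq_bigmax_cond.
apply/existsP; exists x; apply/existsP; exists (in_tuple p) => /=.
rewrite sp lp; apply/set0Pn; by exists v; rewrite inE vx.
Qed.

Lemma bag_lev v x y : v \in bag x -> v \in bag y -> lev x <= lev y + elongation D.
Proof.
move=> vx vy; have [p [/andP[pp _] lp] sz] := bag_dist vy vx.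
apply: leq_trans (_ : lev y + size p <= _); last by rewrite leq_add2l.
elim: p y {vy sz} pp lp => [|z p IH] y /=; first by move=> _ ->; rewrite addn0.
by move=> /andP[/adj_lev eyz /IH{}IH /IH]; case: eyz => -[]; lia.
Qed.

Lemma bag_adj v x y : elongation D <= 1 -> v \in bag x -> v \in bag y -> x = y \/ adj x y.
Proof.
move=> el vx vy; have [[|z [|z' p]] [/andP[pp _] lp] sz] := bag_dist vx vy.
- by left.
- by right; move: pp lp => /= /andP[+ _] <-.
- by move: sz => /=; lia.
Qed.

(** * Branches of the tree at a node *)

Definition branch x v := odflt x [pick z | child x z && (v \in subtree_bag z)].

Lemma branch_child x z v :
  v \notin bag x -> child x z -> v \in subtree_bag z -> branch x v = z.
Proof.
move=> nvx cz vz; rewrite /branch; case: pickP => [z' /andP[cz' vz']|/(_ z)] /=; last first.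
  by rewrite cz vz.
move: vz vz' => /subtree_bagP[y bzy vy] /subtree_bagP[y' bzy' vy'].
have [bzy2|nb] := boolP (below z y'); first exact: below_child_inj cz' cz bzy' bzy2.
have [_] := bag_exit vy vy' bzy nb.
by have /andP[_ /eqP ->] := cz; rewrite (negbTE nvx).
Qed.

(** So among vertices outside [bag x], the default label [x] marks those in the branch of the
    parent. *)
Lemma branch_out x v : v \notin subtree_bag x -> branch x v = x.
Proof.
move=> nvx; rewrite /branch; case: pickP => [z /andP[cz /(subtree_bag_child cz)]|] //.
by rewrite (negbTE nvx).
Qed.

(** A bag holding both ends lies in one branch, as [u] is not in [bag x]. With elongation at most
    one, a vertex [v] of [bag x] occurs in no second branch. *)
Lemma branch_adj x u v : adj u v -> u \notin bag x ->
  v \notin bag x \/ elongation D <= 1 -> branch x u = branch x v.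
Proof.
have half u' v' z : adj u' v' -> u' \notin bag x -> child x z ->
    u' \in subtree_bag z -> v' \in subtree_bag z.
  move=> uv nux /andP[_ /eqP pz] uz; apply: contraNT nux => nvz.
  by have [_] := adj_subtree_bag uv uz nvz; rewrite pz.
move=> uv nux side; congr odflt; apply: eq_pick => z.
case cz: (child x z) => //=.
apply/idP/idP => [|vz]; first exact: half uv nux cz.
have [vx|nvx] := boolP (v \in bag x); last by apply: half vz; rewrite // adj_sym.
have el : elongation D <= 1 by case: side; rewrite ?vx.
have [w [uw vw]] := td_edge_cover D uv.
have [y bzy vy] := subtree_bagP _ _ vz.
have [vbz _] := bag_exit vy vx bzy (child_neq_below cz).
have [ewz|awz] := bag_adj el vw vbz.
  by apply/subtree_bagP; exists z; rewrite ?belowxx -?ewz.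
have [ewx|awx] := bag_adj el vw vx; first by rewrite -ewx uw in nux.
(* A node [w] adjacent to both [z] and its parent [x] would close a triangle; the parity of levels
   rules this out. *)
have := adj_odd_lev awz; rewrite (lev_child cz) /= (adj_odd_lev awx).
by case: (odd _).
Qed.

(** * A simple path and the nodes that it visits *)

Section AvoidingPath.
Variables (x0 : G) (p : seq G) (a K : nat).
Hypothesis path_p : simple_path x0 p.
Hypothesis bag_card : forall x, #|bag x| <= K.
(** With [K = k + 1] the second case asks for [k <= 2 a], which holds when [a] is half of [k]
    rounded up. *)
Hypothesis branching : K <= a \/ elongation D <= 1 /\ K <= a.*2.+1.

Local Notation P := (x0 :: p).

Lemma count_bag x : count [in bag x] P <= K.
Proof.
apply: leq_trans (bag_card x); rewrite -size_filter cardE.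
have /andP[_ uq] := path_p.
apply: uniq_leq_size; first exact: filter_uniq.
by move=> v; rewrite mem_filter mem_enum => /andP[].
Qed.

Lemma size_branches x : size (labels [in bag x] (branch x) P) <= a.+1.
Proof.
have := count_bag x; have /andP[pp _] := path_p.
have [leKa|[el leKa]] := branching => cK.
  have := @size_labels_sep _ _ [in bag x] (branch x) x0 p.
  have -> : path (fun u v => ~~ [in bag x] u && ~~ [in bag x] v ==>
       (branch x u == branch x v)) x0 p.
    apply: sub_path pp => u v uv; apply/implyP => /andP[nu nv].
    by apply/eqP/branch_adj => //; left.
  move=> /(_ isT)/leq_trans; apply.
  by apply: leq_trans (leq_add cK (leq_b1 _)) _; lia.
have := @size_labels_boundary _ _ [in bag x] (branch x) x0 p.
have -> : path (fun u v => ~~ [in bag x] u || ~~ [in bag x] v ==>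
     (branch x u == branch x v)) x0 p.
  apply: sub_path pp => u v uv; apply/implyP => /orP[nu|nv]; apply/eqP.
    by apply: branch_adj => //; right.
  by apply/esym; apply: branch_adj; rewrite // 1?adj_sym //; right.
(* Twice the number of labels is at most [K + 2 <= 2 a + 3], so there are at most [a + 1] labels. *)
move=> /(_ isT) sz; rewrite -ltnS -ltn_double.
by apply: leq_ltn_trans (leq_trans sz (leq_add (leq_add cK (leqnn 1)) (leq_b1 _))) _; lia.
Qed.

(** The nodes of [Z] are distinct labels of [P]; if [P] leaves the subtree at [x], the label [x] of
    the upward branch is one more. *)
Lemma card_branches x (Z : {set td_tree D}) :
  (forall z, z \in Z ->
     child x z /\ has (fun v => (v \in subtree_bag z) && (v \notin bag x)) P) ->
  #|Z| + ~~ all [in subtree_bag x] P <= a.+1.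
Proof.
move=> ZP; apply: leq_trans (size_branches x).
have inl v c : v \in P -> v \notin bag x -> branch x v = c ->
    c \in labels [in bag x] (branch x) P.
  move=> vP nvx <-; rewrite mem_undup; apply: map_f.
  by rewrite mem_filter vP andbT.
have Zl : {subset enum Z <= labels [in bag x] (branch x) P}.
  move=> z; rewrite mem_enum => /ZP[cz /hasP[v vP /andP[vz nvx]]].
  exact: inl vP nvx (branch_child nvx cz vz).
case: allP => [_|/allP/allPn[v vP nvx]]; rewrite cardE.
  by rewrite addn0; apply: uniq_leq_size; rewrite ?enum_uniq.
rewrite addn1 -[_.+1]/(size (x :: enum Z)); apply: uniq_leq_size.
  rewrite /= enum_uniq andbT mem_enum; apply/negP => /ZP[/lev_child]; lia.
move=> z; rewrite inE => /orP[/eqP->|/Zl//]; apply: inl vP _ (branch_out nvx).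
by apply: contra nvx => vx; apply/subtree_bagP; exists x; rewrite ?belowxx.
Qed.

Definition apex := [arg max_(x > r | all [in subtree_bag x] P) lev x].

Lemma apexP : all [in subtree_bag apex] P /\
  forall x, all [in subtree_bag x] P -> lev x <= lev apex.
Proof.
rewrite /apex; case: arg_maxnP => [|x Px xmax]; last by split.
apply/allP => v _; have [y vy] := td_vertex_cover D v.
by apply/subtree_bagP; exists y; rewrite ?below_root.
Qed.

Definition visits x := has (fun v => (v \in subtree_bag x) && (v \notin bag (par x))) P.
Definition visited := [set x | below apex x && ((x == apex) || visits x)].

Lemma lev_visited x : x \in visited -> x != apex -> lev apex < lev x.
Proof.
rewrite inE => /andP[/andP[le_ax /eqP itx] _] nxa.
rewrite ltn_neqAle le_ax andbT; apply: contraNneq nxa => ex.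
by rewrite -itx ex subnn.
Qed.

(** A vertex witnessing the visit of [x] also witnesses that of [par x]: were it in the bag of the
    grandparent, connectedness would put it in [bag (par x)]. *)
Lemma visited_par x : x \in visited -> x != apex -> par x \in visited.
Proof.
move=> xv nxa; have lx := lev_visited xv nxa.
move: xv; rewrite !inE (negbTE nxa) => /andP[bx /hasP[v vP /andP[vx nvp]]].
rewrite (below_par bx nxa) /=; case: eqVneq => //= npa.
have cx : child (par x) x by rewrite /child eqxx andbT; lia.
apply/hasP; exists v => //; rewrite (subtree_bag_child cx vx) /=.
apply: contra nvp => vpp; have [y bxy vy] := subtree_bagP _ _ vx.
have cp : child (par (par x)) (par x).
  rewrite /child eqxx andbT; have := lev_par (leq_ltn_trans (leq0n _) lx).
  have := below_par bx nxa; rewrite /below => /andP[].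
  have [e|] := eqVneq (lev (par x)) (lev apex); last by lia.
  by rewrite e subnn /= => _ /eqP e2; rewrite e2 eqxx in npa.
have [] // := bag_exit vy vpp _ (child_neq_below cp).
exact: child_below bxy.
Qed.

(** A path partly but not wholly in the subtree at [y] has a vertex in both [bag y] and
    [bag (par y)]. By maximality, no node deeper than the apex has all of [P] in its subtree; a
    child of the apex then yields a vertex in the bag of the apex. *)
Lemma visited_meets x : x \in visited -> has [in bag x] P.
Proof.
have /andP[pp _] := path_p; have [allP_apex apex_max] := apexP.
have crossing y : has [in subtree_bag y] P -> ~~ all [in subtree_bag y] P ->
    exists v, [/\ v \in P, v \in bag y & v \in bag (par y)].
  move=> /hasP[u uP uy] /allPn[u' u'P nu'y].
  have [v [v' [evv' vP _ vy nv'y]]] :=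
    path_boundary (@adj_sym G) pp uP u'P uy nu'y.
  by have [] := adj_subtree_bag evv' vy nv'y; exists v.
have [-> _|nxa] := eqVneq x apex; last first.
  move=> xv; have lx := lev_visited xv nxa.
  move: xv; rewrite inE (negbTE nxa) => /andP[_ /hasP[v vP /andP[vx _]]].
  have [||u [uP ux _]] := crossing x; first by apply/hasP; exists v.
    by apply/negP => /apex_max; lia.
  by apply/hasP; exists u.
have [x0a|nx0a] := boolP (x0 \in bag apex); first by rewrite /= x0a.
have /andP[/subtree_bagP[y bay x0y] _] := allP_apex.
have [|z cz bzy] := below_child bay.
  by apply: contraNneq nx0a => <-.
have /andP[_ /eqP pz] := cz.
have [||u [uP _]] := crossing z.
- by apply/hasP; exists x0; rewrite ?mem_head //; apply/subtree_bagP; exists y.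
- by apply/negP => /apex_max; rewrite (lev_child cz) ltnn.
by rewrite pz => ua; apply/hasP; exists u.
Qed.

(** A highest node at or below the apex whose bag holds [v] is the apex itself or has a parent whose
    bag misses [v]. *)
Lemma visited_cover v : v \in P -> exists2 x, x \in visited & v \in bag x.
Proof.
move=> vP; have [/allP/(_ v vP)/subtree_bagP[y bay vy] _] := apexP.
have Py : below apex y && (v \in bag y) by rewrite bay.
have [x /andP[bax vx] xmin] :=
  @arg_minnP _ y (fun y => below apex y && (v \in bag y)) lev Py.
exists x => //; rewrite inE bax; case: eqVneq => //= nxa.
apply/hasP; exists v => //; apply/andP; split.
  by apply/subtree_bagP; exists x; rewrite ?belowxx.
apply/negP => vp; have := xmin (par x); rewrite (below_par bax nxa) vp => /(_ isT).
have lx : 0 < lev x.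
  have /andP[le_ax /eqP itx] := bax; rewrite lt0n; apply: contraNneq nxa => lx0.
  by rewrite -itx lx0.
by have := lev_par lx; lia.
Qed.

Lemma visited_children x : x \in visited ->
  #|[set z in visited | child x z]| <= a + (x == apex).
Proof.
move=> xv; have := @card_branches x [set z in visited | child x z].
have le_ax : lev apex <= lev x by move: xv; rewrite inE => /andP[/andP[]].
have Zx z : z \in [set z in visited | child x z] ->
    child x z /\ has (fun v => (v \in subtree_bag z) && (v \notin bag x)) P.
  rewrite !inE => /andP[/andP[_ vz] cz]; split=> //.
  have /andP[_ /eqP pz] := cz.
  case: eqVneq vz => [za|_]; last by rewrite /visits pz.
  by move: (lev_child cz) le_ax; rewrite za => ->; rewrite ltnn.
move=> /(_ Zx); case: eqVneq => [_|nxa]; first by lia.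
suff -> : all [in subtree_bag x] P = false by lia.
have [_ apex_max] := apexP; apply/negP => /apex_max.
by have := lev_visited xv nxa; lia.
Qed.

Lemma card_visited_level j :
  #|[set x in visited | lev x == lev apex + j]| <= level_bound a j.
Proof.
elim: j => [|j IH] /=.
  rewrite -(cards1 apex); apply/subset_leq_card/subsetP => x; rewrite inE addn0.
  move=> /andP[xv /eqP lx]; rewrite inE; apply/negPn/negP => /(lev_visited xv).
  by rewrite lx ltnn.
set S := [set _ in _ | _] in IH.
have -> : [set x in visited | lev x == lev apex + j.+1] =
    \bigcup_(x in S) [set z in visited | child x z].
  apply/setP => z; apply/idP/bigcupP => [|[x]].
    rewrite inE => /andP[zv /eqP lz].
    have nza : z != apex by apply: contra_eq_neq lz => ->; lia.
    have lp := @lev_par z; exists (par z).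
      by rewrite inE visited_par //=; apply/eqP; lia.
    by rewrite inE zv /child eqxx andbT; lia.
  rewrite !inE => /andP[_ /eqP lx] /andP[-> /lev_child ->] /=.
  by rewrite lx addnS.
apply: leq_trans (leq_card_bigcup _ _) _.
apply: (@leq_trans (\sum_(x in S) (a + (j == 0)))).
  apply: leq_sum => x; rewrite inE => /andP[xv /eqP lx].
  apply: leq_trans (visited_children xv) _; rewrite leq_add2l.
  by case: eqVneq lx => // -> ; case: j {IH S} => //=; lia.
rewrite sum_nat_const; apply: leq_trans (leq_mul IH (leqnn _)) _.
case: (j) => [|j'] /=; first by rewrite addn1 expn0 mul1n muln1.
by rewrite addn0 -mulnA -expnSr.
Qed.

(** The ancestors of a visited node up to the apex are visited and meet [P], so they cannot fill
    [h + 2] consecutive levels. Hence visited nodes lie at depth at most [h] below the apex, and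
    their bags cover [P]. *)
Lemma avoiding_path_size h i :
  (forall x, lev x = i %[mod h.+2] -> ~~ has [in bag x] P) ->
  size P <= tree_bound a h * K.
Proof.
move=> avoid.
have chain x j : x \in visited -> j <= lev x - lev apex -> iter j par x \in visited.
  move=> xv; elim: j => [|j IH] //= lj; apply: visited_par; first by apply: IH; lia.
  apply: contraTneq lj => e; have := @lev_iter_par j x; rewrite e; lia.
have lev_lt x : x \in visited -> lev x - lev apex < h.+1.
  move=> xv; rewrite ltnNge; apply/negP => lx.
  (* Climbing [j] steps from [x] reaches a level congruent to [i]; the inner difference stands for
     [-i] modulo [h.+2]. *)
  pose j := (lev x + (h.+2 - i %% h.+2)) %% h.+2.
  have ltj : j < h.+2 by rewrite ltn_mod.
  have lej : j <= lev x by lia.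
  have meets : has [in bag (iter j par x)] P.
    by apply/visited_meets/chain => //; apply: leq_trans lx; rewrite -ltnS.
  suff /avoid : lev (iter j par x) = i %[mod h.+2] by rewrite meets.
  apply/eqP; rewrite lev_iter_par // -(eqn_modDr j) subnK // modnDmr -(modnDml i).
  have lti : i %% h.+2 < h.+2 by rewrite ltn_mod.
  by rewrite addnCA subnKC ?modnDr // ltnW.
have /andP[_ uq] := path_p.
have -> : size P = #|[set v in P]| by rewrite cardsE; have /card_uniqP -> := uq.
have Psub : [set v in P] \subset \bigcup_(x in visited) bag x.
  apply/subsetP => v; rewrite inE => /visited_cover[x xv vx].
  by apply/bigcupP; exists x.
apply: leq_trans (subset_leq_card Psub) _.
apply: leq_trans (leq_card_bigcup _ _) _.
apply: (@leq_trans (\sum_(x in visited) K)); first exact: leq_sum.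
rewrite sum_nat_const leq_mul2r; apply/orP; right.
rewrite -sum1_card (partition_big (fun x => inord (lev x - lev apex) : 'I_h.+1) xpredT) //=.
apply: leq_sum => j _; rewrite sum1_card.
apply: leq_trans (card_visited_level j); apply: subset_leq_card.
apply/subsetP => x; rewrite !inE => /andP[xv /eqP <-]; have := xv; rewrite inE => ->.
rewrite inordK ?lev_lt //=; move: xv; rewrite inE => /andP[/andP[le_ax _] _].
by rewrite subnKC.
Qed.

End AvoidingPath.

End RootedDecomposition.

Local Open Scope ring_scope.

(** * Closed forms of the bound and the choice of levels *)

Lemma tree_bound1 h : tree_bound 1 h = (h.*2.+1)%N.
Proof.
elim: h => [|h IH]; first by rewrite /tree_bound big_ord1.
by rewrite /tree_bound big_ord_recr /= -/(tree_bound 1 h) IH exp1n; lia.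
Qed.

(** The geometric sum for branching number [a + 1], arranged without subtraction or division. *)
Lemma tree_boundE a h : (a * tree_bound a.+1 h + 2 = a.+1 ^ h * a.+2)%N.
Proof.
elim: h => [|h IH]; first by rewrite /tree_bound big_ord1 /= expn0; lia.
rewrite /tree_bound big_ord_recr /= -/(tree_bound a.+1 h) mulnDr addnAC IH expnS.
by ring.
Qed.

(** Averaging: each vertex counts at most [c] times, so the [c t] sets together weigh at most [c]
    times the total weight. *)
Lemma light_member (R : realType) (V I : finType) (w : V -> R) (U : I -> {set V})
    (c t : nat) : (forall v, 0 <= w v) -> (0 < t)%N -> (0 < c)%N ->
  #|I| = (c * t)%N -> (forall v, #|[set i | v \in U i]| <= c)%N ->
  exists i, \sum_(v in U i) w v <= (\sum_v w v) / t%:R.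
Proof.
move=> w0 t0 c0 cardI cov; apply/existsP; apply: contraT => /existsPn heavy.
have tR : (t%:R : R) != 0 by rewrite pnatr_eq0 -lt0n.
have : \sum_(i : I) (\sum_v w v) / t%:R < \sum_(i : I) \sum_(v in U i) w v.
  apply: ltr_sum => [|i _]; last by rewrite ltNge heavy.
  have /card_gt0P[i _] : (0 < #|I|)%N by rewrite cardI muln_gt0 c0.
  by apply/hasP; exists i; rewrite ?mem_index_enum.
rewrite sumr_const cardI -[X in X < _]mulr_natr natrM mulrCA divfK // mulrC.
apply: contraTT => _; rewrite -leNgt.
have -> : \sum_(i : I) \sum_(v in U i) w v = \sum_v w v *+ #|[set i | v \in U i]|.
  rewrite (exchange_big_dep xpredT) //=; apply: eq_bigr => v _.
  by rewrite sumr_const cardsE.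
rewrite mulr_suml; apply: ler_sum => v _.
by rewrite mulr_natr ler_wpMn2l.
Qed.

Lemma tree_trimming (R : realType) (G : sgraph) (w : G -> R)
    (D : tree_decomposition G) (s a K t h : nat) :
  (forall v, 0 <= w v) -> (elongation D <= s)%N ->
  (forall x : td_tree D, #|td_bag x| <= K)%N ->
  (K <= a)%N \/ (elongation D <= 1)%N /\ (K <= a.*2.+1)%N ->
  (s.+1 * t = h.+2)%N ->
  exists U : {set G}, trimming w t%:R (tree_bound a h * K)%:R U.
Proof.
move=> w0 els cK br hE.
have [lev [par [r [adj_lev lev_par lev_root]]]] := tree_rooting (td_tree_is_tree D).
pose U (i : 'I_h.+2) : {set G} := \bigcup_(x : td_tree D | (lev x %% h.+2)%N == i) td_bag x.
have t0 : (0 < t)%N by case: (t) hE => //; rewrite muln0.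
have [|||i Ui] := light_member (U := U) (c := s.+1) w0 t0 => //.
- by rewrite card_ord.
- move=> v; have [x0 vx0] := td_vertex_cover D v.
  (* All occurrences of [v] lie within [s] levels below a highest one, hence in at most [s + 1]
     residue classes. *)
  have [x vx xmin] := @arg_minnP _ x0 (fun x => v \in td_bag x) lev vx0.
  have sub : [set i | v \in U i] \subset
      [set inord ((lev x + j) %% h.+2) | j : 'I_s.+1].
    apply/subsetP => i; rewrite inE => /bigcupP[y /eqP ly vy].
    have lxy := xmin y vy; have lyx := bag_lev adj_lev vy vx.
    have ltj : (lev y - lev x < s.+1)%N by lia.
    apply/imsetP; exists (Ordinal ltj) => //=.
    by rewrite subnKC // ly inord_val.
  apply: leq_trans (subset_leq_card sub) _.
  by apply: leq_trans (leq_imset_card _ _) _; rewrite card_ord.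
exists (U i); split=> // x p sp; rewrite ltr_nat => lt_p.
apply/exists_inP; apply: contraLR lt_p => nU; rewrite -leqNgt.
(* The bound is on the number of vertices, one more than the number of edges. *)
apply: ltnW; apply: (avoiding_path_size adj_lev lev_par lev_root sp cK br (i := i)).
move=> y; rewrite (modn_small (ltn_ord i)) => ly; apply: contra nU => /hasP[v vp vy].
by apply/exists_inP; exists v => //; apply/bigcupP; exists y; rewrite ?ly.
Qed.

Theorem theorem2p1 (R : realType) :
  (forall (k s : nat) (G : sgraph) (w : G -> R) (D : tree_decomposition G),
     (forall v, 0 <= w v) ->
     width D = k%:Z -> elongation D = s ->
     let a := (if 2 <= s then k + 1 else uphalf k)%N in
     forall t : nat, (2 <= t)%N ->
     let g : R :=
       if (a <= 1)%N then (2 * (s%:R + 1) * t%:R - 3) * (k%:R + 1)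
       else (a%:R ^+ ((s + 1) * t - 2)%N * (a%:R + 1) - 2) * (k%:R + 1)
              / (a%:R - 1) in
     exists U : {set G}, trimming w t%:R g U)
  /\
  (forall (s : nat) (F : sgraph -> Prop),
     bounded_elongation_treewidth s F -> trimmable R F).
Proof.
split=> [k s G w D w0 wD elD a t t2 g|s F [k bdF] t t0].
  have cK (x : td_tree D) : (#|td_bag x| <= k.+1)%N.
    have : (\max_(x : td_tree D) #|td_bag x| = k.+1)%N by move: wD; rewrite /width; lia.
    by move=> <-; exact: leq_bigmax.
  pose h := ((s + 1) * t - 2)%N.
  have hE : (s.+1 * t = h.+2)%N.
    by have := leq_mul (isT : 0 < s.+1)%N t2; rewrite /h addn1; lia.
  (* For [a = 0] the stated bound is the one for branching number 1, hence the maximum. *)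
  have [||U] := @tree_trimming R G w D s (maxn a 1) k.+1 t h w0 _ cK _ hE.
  - by rewrite elD.
  - by rewrite elD /a; case: ifP => s2; [left|right]; lia.
  suff -> : ((tree_bound (maxn a 1) h * k.+1)%N%:R : R) = g by exists U.
  have kR : (k.+1%:R : R) = k%:R + 1 by rewrite -natr1.
  rewrite /g natrM kR; case: leqP => a1.
    rewrite tree_bound1; congr (_ * _).
    have : ((s.+1 * t)%N%:R : R) = h.+2%:R by rewrite hE.
    rewrite natrM -!natr1 -muln2 natrM; lra.
  rewrite -/h; case: (a) a1 => // b b1.
  have bR : (b%:R : R) != 0 by rewrite pnatr_eq0; lia.
  have := congr1 (fun n => n%:R : R) (tree_boundE b h).
  rewrite natrD !natrM natrX -!natr1 => e; rewrite addrK.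
  have eb : b%:R * (tree_bound b.+1 h)%:R = (b%:R + 1) ^+ h * (b%:R + 1 + 1) - 2 :> R.
    by rewrite -e; ring.
  by apply: (mulfI bR); rewrite mulrA eb; field.
(* [K] will bound the bag sizes. The real [t] is replaced by an integer larger than [t] and at least
   2; a trimming for it is one for [t], as weights are nonnegative. *)
pose K := `|(k + 1)%R|%N; pose h := (s.+1 * (Num.truncn t).+2 - 2)%N.
exists (tree_bound K.+1 h * K)%:R => // G w FG w0.
have [D [elD wD]] : has_decomposition s G (elongation_treewidth s G).
  rewrite /elongation_treewidth; case: ex_minnP => n /asboolP hn _; exact: hn.
have cK (x : td_tree D) : (#|td_bag x| <= K)%N.
  apply: (@leq_trans (\max_(x : td_tree D) #|td_bag x|)%N); first exact: leq_bigmax.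
  by have := bdF G FG; rewrite -wD /width /K; lia.
have [|U [wU pU]] := 
  @tree_trimming R G w D s K.+1 K (Num.truncn t).+2 h w0 elD cK (or_introl (leqnSn K)).
  by have := leq_mul (isT : 0 < s.+1)%N (isT : 1 < (Num.truncn t).+2)%N; rewrite /h; lia.
exists U; split=> //; apply: le_trans wU _.
apply: ler_wpM2l; first exact: sumr_ge0.
rewrite lef_pV2 ?posrE ?ltr0n //; apply: ltW (lt_trans (truncnS_gt t) _).
by rewrite ltr_nat.
Qed.
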